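(* Define $\Delta_1=1$ and $\Delta_{i+1}=2^{\Delta_i}+\Delta_i$ for $i\ge 1$, and let $\alpha=\sum_{i=1}^{\infty}\frac{1}{2^{\Delta_i}}$. Then for all $n\in\mathbb{N}\cup\{0\}$ one has $\{2^n n\alpha\}<\frac12$, and the sequence $(\{2^n n\alpha\})_{n\ge 0}$ is not dense in the interval $[0,1]$.
   Context: $\{x\}=x-\lfloor x\rfloor$ denotes the fractional part of a real number $x$. *)

(* Defs.v *)
From HB Require Import structures.
From mathcomp Require Import all_boot all_order all_algebra.
From mathcomp Require Import all_classical all_reals all_analysis.
Set Implicit Arguments.
Unset Strict Implicit.
Unset Printing Implicit Defensive.
Import Order.TTheory GRing.Theory Num.Theory.
Import numFieldNormedType.Exports.
Local Open Scope classical_set_scope.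
Local Open Scope ring_scope.

(* Indexed from 1; the value at 0 is a dummy, never used below. *)
Fixpoint Delta (i : nat) : nat :=
  if i is j.+1 then (if j is 0 then 1 else 2 ^ Delta j + Delta j)%N else 0%N.
Arguments Delta : simpl never.

Lemma Delta1 : Delta 1 = 1%N. Proof. by []. Qed.

Lemma DeltaS (i : nat) :
  (1 <= i)%N -> Delta i.+1 = (2 ^ Delta i + Delta i)%N.
Proof. by case: i. Qed.

Definition alpha (R : realType) : R :=
  \big[+%R/0]_(1 <= i <oo) (1 / 2 ^+ Delta i : R).

Definition fractional_part (R : realType) (x : R) : R := x - (Num.floor x)%:~R.

(* [S] need not be included in [A]. *)
Definition dense_in (T : topologicalType) (A S : set T) : Prop :=
  A `<=` closure S.

(* Main.v *)
(** Multiplying [alpha] by [2^n] with [Delta i <= n < Delta i.+1] and writing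
    [k = Delta i.+1 - n], the terms up to index [i] become integers, the next
    one becomes [n / 2^k = (Delta i.+1 - k) / 2^k], and the remaining tail
    contributes less than [1 / 2^k]. So it suffices that the residue of
    [Delta i - k] modulo [2^k] is below [2^(k-1)] for [1 <= k <= Delta i];
    this goes by induction on [i]: if [k <= Delta i], then
    [Delta i.+1 = Delta i] modulo [2^k], and otherwise
    [Delta i.+1 - k < 2^(Delta i) <= 2^(k-1)]. *)

Require Import Defs.
From HB Require Import structures.
From mathcomp Require Import all_boot all_order all_algebra.
From mathcomp Require Import all_classical all_reals all_analysis.
From mathcomp Require Import zify ring lra.
Import Order.TTheory GRing.Theory Num.Theory.
Import numFieldNormedType.Exports.
Local Open Scope classical_set_scope.
Local Open Scope ring_scope.

Lemma ltn_DeltaS (i : nat) : (Delta i < Delta i.+1)%N.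
Proof.
case: i => [//|i].
by rewrite (DeltaS (i := i.+1)) // -[ltnLHS]add0n ltn_add2r expn_gt0.
Qed.

Lemma leq_Delta (i j : nat) : (i <= j)%N -> (Delta i <= Delta j)%N.
Proof. by apply: (homo_leq leqnn leq_trans) => k; exact/ltnW/ltn_DeltaS. Qed.

(** Strict growth of [Delta] makes these blocks cover all naturals; the value [Delta 0 = 0] supplies
    the block of [n = 0]. *)
Lemma Delta_bracket (n : nat) : exists i, (Delta i <= n < Delta i.+1)%N.
Proof.
elim: n => [|n [i /andP[lo hi]]]; first by exists 0%N.
move: hi; rewrite leq_eqVlt => /orP[/eqP hi|hi].
  by exists i.+1; rewrite -hi leqnn hi ltn_DeltaS.
by exists i; rewrite hi (leq_trans lo).
Qed.

Lemma modn_Delta_subn (i k : nat) : (1 <= i)%N -> (1 <= k <= Delta i)%N ->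
  ((Delta i - k) %% 2 ^ k < 2 ^ k.-1)%N.
Proof.
elim: i k => // -[_ k _|i IHi k _].
  by rewrite Delta1; case: k => [|[|k]].
rewrite DeltaS // => /andP[k_gt0 kle].
case: (leqP k (Delta i.+1)) => [kle'|kgt].
  rewrite -addnBA // -{1}(subnK kle') expnD modnMDl.
  by apply: IHi => //; rewrite k_gt0.
apply: leq_ltn_trans (leq_mod _ _) _.
apply: (@leq_trans (2 ^ Delta i.+1)); first by lia.
by rewrite leq_exp2l //; lia.
Qed.

Section AlphaBounds.
Context {R : realType}.

Definition alpha_partial (m : nat) : R := \sum_(1 <= j < m) (1 / 2 ^+ Delta j).

Lemma alpha_partial_nondecreasing : nondecreasing_seq alpha_partial.
Proof.
apply/nondecreasing_seqP => -[|m]; rewrite /alpha_partial.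
  by rewrite !big_geq.
by rewrite [leRHS]big_nat_recr //= lerDl divr_ge0 // exprn_ge0.
Qed.

(* [2^-Delta j <= 2 * 2^-Delta j - 2 * 2^-Delta j.+1], which telescopes. *)
Lemma alpha_partial_shift_nonincreasing (m n : nat) : (1 <= m <= n)%N ->
  alpha_partial n + 2 / 2 ^+ Delta n <= alpha_partial m + 2 / 2 ^+ Delta m.
Proof.
move=> /andP[m_gt0]; elim: n => [|n IHn].
  by rewrite leqn0 => /eqP ->.
rewrite leq_eqVlt => /orP[/eqP -> //|]; rewrite ltnS => mn.
apply: le_trans (IHn mn); rewrite /alpha_partial big_nat_recr /=; last first.
  exact: leq_trans mn.
have : 2 / 2 ^+ Delta n.+1 <= 1 / 2 ^+ Delta n :> R.
  rewrite ler_pdivrMr ?exprn_gt0 // mulrAC ler_pdivlMr ?exprn_gt0 // mul1r.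
  by rewrite -exprS ler_eXn2l ?ltr1n // ltn_DeltaS.
lra.
Qed.

(** The partial sums increase to [alpha], and the telescoped bound passes to the limit. As
    [alpha_partial m] stops before index [m], the error is at most twice the first omitted term. *)
Lemma alpha_bounds (m : nat) : (1 <= m)%N ->
  alpha_partial m <= alpha R <= alpha_partial m + 2 / 2 ^+ Delta m.
Proof.
move=> m_gt0.
have tail_ge0 n : 0 <= 2 / 2 ^+ Delta n :> R by rewrite divr_ge0 // exprn_ge0.
have ub n : alpha_partial n <= alpha_partial m + 2 / 2 ^+ Delta m.
  case: (leqP m n) => [mn|/ltnW nm].
    have := alpha_partial_shift_nonincreasing m n; rewrite m_gt0 mn => /(_ isT).
    by have := tail_ge0 n; lra.
  by rewrite -[leLHS]addr0 lerD // alpha_partial_nondecreasing.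
have cv : cvgn alpha_partial.
  apply: nondecreasing_is_cvgn; first exact: alpha_partial_nondecreasing.
  by exists (alpha_partial m + 2 / 2 ^+ Delta m) => _ [n _ <-].
apply/andP; split.
  exact: (nondecreasing_cvgn_le alpha_partial_nondecreasing cv).
by apply: limr_le => //; apply: nearW.
Qed.

Lemma expr2_alpha_partial_nat (i n : nat) : (Delta i <= n)%N ->
  exists q : nat, 2 ^+ n * alpha_partial i.+1 = q%:R.
Proof.
move=> lin; exists (\sum_(1 <= j < i.+1) 2 ^ (n - Delta j))%N.
rewrite natr_sum mulr_sumr; apply: eq_big_nat => j /andP[_ ji].
have jn : (Delta j <= n)%N by apply: leq_trans lin; apply: leq_Delta.
by rewrite natrX mul1r expfB_cond ?pnatr_eq0 // leqW.
Qed.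

Lemma fractional_partE (q : nat) (x y : R) :
  x = q%:R + y -> 0 <= y < 1 -> fractional_part x = y.
Proof.
move=> -> /andP[y_ge0 y_lt1]; rewrite /fractional_part.
rewrite (@floor_def _ _ (q%:Z)); first by rewrite -pmulrn addrC addKr.
by rewrite intrD -!pmulrn; apply/andP; split; lra.
Qed.

Lemma fractional_part_alpha_lt_half (n : nat) :
  fractional_part (2 ^+ n * n%:R * alpha R) < 1 / 2.
Proof.
have [i /andP[lo hi]] := Delta_bracket n.
set k := (Delta i.+1 - n)%N.
have k_gt0 : (0 < k)%N by rewrite subn_gt0.
have nE : n = (Delta i.+1 - k)%N by rewrite /k; lia.
have rlt : (n %% 2 ^ k < 2 ^ k.-1)%N.
  by rewrite {1}nE modn_Delta_subn // k_gt0 leq_subr.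
have [q qE] := expr2_alpha_partial_nat _ _ lo.
(* Index [i.+2] keeps the terms up to [i.+1], so the tail starts with [Delta i.+2]. *)
have /andP[aL aU] := alpha_bounds i.+2 isT.
have pow_gt0 m : 0 < 2 ^+ m :> R by rewrite exprn_gt0.
have lastE : 2 ^+ n * (1 / 2 ^+ Delta i.+1) = 1 / 2 ^+ k :> R.
  have -> : Delta i.+1 = (n + k)%N by rewrite /k; lia.
  by rewrite exprD; field; rewrite !lt0r_neq0.
(* Division of [n] by [2 ^ k] splits [n / 2 ^ k], the contribution of term [i.+1], into an integer
   and a proper fraction. *)
have mainE : 2 ^+ n * n%:R * alpha_partial i.+2 =
    (n * q + n %/ 2 ^ k)%:R + (n %% 2 ^ k)%:R / 2 ^+ k.
  rewrite /alpha_partial big_nat_recr //= mulrAC mulrDr qE lastE.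
  have -> : (n %% 2 ^ k)%:R = n%:R - (n %/ 2 ^ k)%:R * 2 ^+ k :> R.
    by rewrite -natrX -natrM {2}(divn_eq n (2 ^ k)) natrD addrC addKr.
  rewrite natrD natrM.
  by field; rewrite lt0r_neq0.
have c_ge0 : 0 <= 2 ^+ n * n%:R :> R by rewrite mulr_ge0 // ltW.
(* Since [Delta i.+2 - Delta i.+1 = 2 ^ Delta i.+1], this reduces to [n * 2 < 2 ^ (2 ^ Delta i.+1)],
   which follows from [n < 2 ^ n] and [n < Delta i.+1 < 2 ^ Delta i.+1]. *)
have tail_lt : 2 ^+ n * n%:R * (2 / 2 ^+ Delta i.+2) < 1 / 2 ^+ k :> R.
  rewrite -lastE -mulrA ltr_pM2l // mulrA ltr_pdivrMr // mulrAC mul1r.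
  rewrite ltr_pdivlMr // (DeltaS (i := i.+1)) // exprD ltr_pM2r //.
  rewrite -natrM -natrX ltr_nat.
  apply: leq_trans (_ : 2 ^ n.+1 <= _)%N.
    by rewrite expnS mulnC ltn_pmul2l // ltn_expl.
  by rewrite leq_exp2l // (leq_trans hi) // ltnW // ltn_expl.
set t := 2 ^+ n * n%:R * (alpha R - alpha_partial i.+2).
have t_ge0 : 0 <= t by rewrite mulr_ge0 // subr_ge0.
have t_lt : t < 1 / 2 ^+ k.
  by apply: le_lt_trans tail_lt; apply: ler_wpM2l => //; lra.
have r_ge0 : 0 <= (n %% 2 ^ k)%:R / 2 ^+ k :> R by rewrite divr_ge0 // ltW.
(* The residue is an integer strictly below [2 ^ k.-1], so one more unit [1 / 2 ^ k] still fits
   under [1 / 2]; the tail uses up less than that unit. *)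
have r_le : (n %% 2 ^ k)%:R / 2 ^+ k + 1 / 2 ^+ k <= 1 / 2 :> R.
  have -> : 2 ^+ k = 2 * 2 ^+ k.-1 :> R by rewrite -exprS prednK.
  rewrite -mulrDl ler_pdivrMr ?mulr_gt0 // natr1 mulrA divfK ?pnatr_eq0 //.
  by rewrite mul1r -natrX ler_nat.
rewrite (fractional_partE (n * q + n %/ 2 ^ k)
          _ ((n %% 2 ^ k)%:R / 2 ^+ k + t)).
- by lra.
- by rewrite addrA -mainE /t; ring.
- by apply/andP; split; lra.
Qed.

End AlphaBounds.

Theorem theorem5 (R : realType) :
  (forall n : nat, fractional_part (2 ^+ n * n%:R * alpha R) < 1 / 2) /\
  ~ dense_in (`[0, 1]%classic : set R)
      (range (fun n : nat => fractional_part (2 ^+ n * n%:R * alpha R))).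
Proof.
split=> [n|dense]; first exact: fractional_part_alpha_lt_half.
(* Density would put the point 1 in the closure of a half-line that is already closed and does not
   contain it. *)
have : closure [set x : R | x <= 1 / 2] 1.
  apply: closure_subset (dense _ _); last by rewrite /= in_itv /= ler01 lexx.
  by move=> _ [n _ <-]; exact/ltW/fractional_part_alpha_lt_half.
by move=> /closed_le le_half; have : (1 : R) <= 1 / 2 := le_half; lra.
Qed.
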